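(* There are no positive integers $n, b, a_1, a_2 \in \mathbb{Z}^+$ satisfying the system \[ \begin{cases} n = a_1 + a_2,\\ a_1 a_2 (a_1 + a_2) = b^3. \end{cases} \]
   Context: $\mathbb{Z}^+$ denotes the set of positive integers. *)

(* Defs.v *)
From mathcomp Require Export all_boot.

(* Main.v *)
Require Import Defs.
From mathcomp Require Import all_boot.
From mathcomp Require Import all_order all_algebra.
From mathcomp Require Import zify ring.
Import Order.TTheory GRing.Theory Num.Theory.
Local Open Scope ring_scope.

(** Dividing [a1] and [a2] by their gcd leaves coprime positive integers
[u], [v] with [u * v * (u + v)] a cube, so that [u], [v] and [w = - (u + v)]
are pairwise coprime integers of sum zero whose product is a nonzero cube
(the gcd of the original pair comes out of the cube root).  Such a triple
cannot exist, by Euler's descent for Fermat's equation of exponent three.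

Pairwise coprime factors of a cube are cubes, so [u = x ^+ 3], [v = y ^+ 3],
[w = z ^+ 3], where one may take [z] even and [x], [y] odd.  Writing
[x = p + q] and [y = p - q] turns [x ^+ 3 + y ^+ 3 = (- z) ^+ 3] into
[2 * p * (p ^+ 2 + 3 * q ^+ 2) = (- z) ^+ 3].  The two factors are coprime up
to a possible common factor 3, so [p ^+ 2 + 3 * q ^+ 2] is a cube, or three
times a cube when 3 divides [p].  For coprime [p] and [q] of opposite
parity, [p ^+ 2 + 3 * q ^+ 2] is a cube only if [p + q * sqrt (-3)] is a cube
in Z[sqrt (-3)] ([cube_root_sqrD3]), which factors [p] and [q] explicitly:
[p = a * (a - 3 * b) * (a + 3 * b)], [q = 3 * b * (a - b) * (a + b)].
The other factor [2 * p] being a cube too, so is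
[2 * a * (a - 3 * b) * (a + 3 * b)]: up to sign, a product of three coprime
integers of sum zero, with a smaller cube root.  If [p = 3 * t], the same
formulas apply to [q] and [t] in place of [p] and [q], and since [18 * t] is
a cube, so is [2 * b * (a - b) * (a + b)] ([descent_step]).

Z[sqrt (-3)] is not factorial, but only odd norms matter here, and
for them no ideal theory is required.  If [s] is odd and divides
[m ^+ 2 + 3], a Fermat-style descent on [s] represents it as
[a ^+ 2 + 3 * b ^+ 2] with [a] congruent to [m * b] ([sqrD3_repr]): this is an
element of norm [s] in the kernel of the reduction [sqrt (-3) -> - m] modulo
[s].  Its cube lies in the kernel modulo [s ^+ 3], as does [p + q * sqrt (-3)]
when [m] is [p / q] modulo [s ^+ 3].  Both have norm [s ^+ 3], so they differ
by a unit of norm 1, that is, by a sign. *)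

(** * Divisibility and cubes among coprime integers *)

Lemma even_mulz (x y : int) : (2 %| x * y)%Z = (2 %| x)%Z || (2 %| y)%Z.
Proof. by rewrite !dvdzE abszM Euclid_dvdM. Qed.

Lemma coprimez_dvd (x y d e : int) :
  (d %| x)%Z -> (e %| y)%Z -> coprimez x y -> coprimez d e.
Proof.
rewrite !dvdzE !coprimezE => d_x e_y co_xy.
exact/(coprime_dvdl d_x)/(coprime_dvdr e_y).
Qed.

Lemma coprimez_prime (l : nat) (x : int) :
  prime l -> coprimez l x = ~~ (l %| x)%Z.
Proof. by move=> l_pr; rewrite coprimezE dvdzE prime_coprime. Qed.

Lemma coprimez_Nboth_even (x y : int) :
  coprimez x y -> (2 %| x)%Z -> ~~ (2 %| y)%Z.
Proof.
move=> co_xy x_even; apply/negP => y_even.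
by have := coprimez_dvd _ _ _ _ x_even y_even co_xy.
Qed.

(** With [g] the gcd of [x] and [c], [x = x' * g] and [c = c' * g], the
equation becomes [x' * y = g ^ 2 * c' ^ 3]; as [x'] is prime to [c'] and [g]
to [y], [x'] and [g ^ 2] divide each other.  Hence [x' = g ^ 2] and
[x = g ^ 3]. *)
Lemma coprime_mul_cube (x y c : nat) :
  coprime x y -> (x * y = c ^ 3)%N -> x = (gcdn x c ^ 3)%N.
Proof.
have [-> | x_gt0] := posnP x.
  by move=> _ /esym/eqP; rewrite mul0n expn_eq0 => /andP[/eqP-> _].
set g := gcdn x c; have g_gt0 : (0 < g)%N by rewrite gcdn_gt0 x_gt0.
have /dvdnP[x' x_g] : (g %| x)%N by apply: dvdn_gcdl.
have /dvdnP[c' c_g] : (g %| c)%N by apply: dvdn_gcdr.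
have co_xc : coprime x' c'.
  have := erefl g; rewrite {1}/g x_g c_g -muln_gcdl => /eqP.
  by rewrite -{2}[g]mul1n eqn_pmul2r.
clearbody g; rewrite {}x_g {}c_g coprimeMl {x_gt0} => /andP[_ co_gy] xy_c.
have {}xy_c : (x' * y = g ^ 2 * c' ^ 3)%N by nia.
suff -> : x' = (g ^ 2)%N by rewrite -expnSr.
apply/eqP; rewrite eqn_dvd; apply/andP; split.
  by rewrite -(@Gauss_dvdl _ _ (c' ^ 3)) ?coprimeXr // -xy_c dvdn_mulr.
by rewrite -(@Gauss_dvdl _ _ y) ?coprimeXl // xy_c dvdn_mulr.
Qed.

Lemma coprimez_mul_cube (x y c : int) :
  coprimez x y -> x * y = c ^+ 3 -> exists r, x = r ^+ 3.
Proof.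
rewrite coprimezE => co_xy /(congr1 absz); rewrite abszM abszX.
move=> /(coprime_mul_cube _ _ _ co_xy); move: (gcdn _ _) => r x_r.
have [x_ge0 | x_lt0] := boolP (0 <= x).
  by exists r%:Z; lia.
by exists (- r%:Z); lia.
Qed.

Lemma cube_factor_lt (c s z : int) :
  (c * s) ^+ 3 = z ^+ 3 -> 1 < s -> z != 0 -> `|c| < `|z|.
Proof.
move=> /(congr1 Num.norm); rewrite !normrX => /eqP.
rewrite eqrXn2 // => /eqP cs_z s_gt1; rewrite -normr_gt0 -cs_z normrM => cs_gt0.
have c_gt0 : 0 < `|c|.
  by rewrite normr_gt0; apply: contraTneq cs_gt0 => ->; rewrite normr0 mul0r.
rewrite ltr_pMr // ger0_norm //; lia.
Qed.

(** * Norms from Z[sqrt (-3)] *)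

(** A solution for [s] follows from one for the cofactor [t] of
[e ^+ 2 + 3 = t * s]: if [a + b * r] has norm [t], where [r ^+ 2 = - 3], then
[(e + r) * (a - b * r) / t] has norm [s].  The congruence on [a] says exactly
that this quotient lies in Z[r], which is why it is part of the statement.
Taking [e] even, congruent to [m] and smaller than [s] in absolute value,
makes [t] odd and smaller than [s]. *)
Lemma sqrD3_repr (s m : int) :
  0 < s -> ~~ (2 %| s)%Z -> (s %| m ^+ 2 + 3)%Z ->
  exists a b : int, s = a ^+ 2 + 3 * b ^+ 2 /\ (s %| a - m * b)%Z.
Proof.
have [n] : exists n : nat, s < n%:Z by exists `|s|.+1; lia.
elim: n s m => [|n IHn] s m lt_sn s_gt0 s_odd s_dvd; first by lia.
have [s1 | s_neq1] := eqVneq s 1; first by exists 1, 0; rewrite s1 dvd1z.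
(* One of the residue [m %% s] and its translate by the odd [s] is even. *)
have [e [m_e e_even e_small]] :
    exists e : int, [/\ (s %| m - e)%Z, (2 %| e)%Z & - s < e < s].
  exists (if (2 %| m %% s)%Z then (m %% s)%Z else (m %% s)%Z - s).
  have r_ge0 : 0 <= (m %% s)%Z by rewrite modz_ge0 //; lia.
  have r_lts : (m %% s)%Z < s by rewrite ltz_pmod.
  have m_divs := divz_eq m s; move: r_ge0 r_lts m_divs.
  move: (m %% s)%Z (m %/ s)%Z => r k r_ge0 r_lts ->.
  case: ifP => r_even; split; try lia.
    by apply/dvdzP; exists k; ring.
  by apply/dvdzP; exists (k + 1); ring.
have /dvdzP[t e_t] : (s %| e ^+ 2 + 3)%Z.
  have /dvdzP[k mk] := m_e; have /dvdzP[l ml] := s_dvd.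
  apply/dvdzP; exists (l - k * (m + e)).
  have -> : e ^+ 2 + 3 = m ^+ 2 + 3 - (m - e) * (m + e) by ring.
  by rewrite ml mk; ring.
have t_gt0 : 0 < t by nia.
have t_lts : t < s by nia.
have t_odd : ~~ (2 %| t)%Z.
  apply/negP => t_even; have : (2 %| e ^+ 2 + 3)%Z by rewrite e_t dvdz_mulr.
  by have /dvdzP[k ->] := e_even; lia.
have t_dvd : (t %| e ^+ 2 + 3)%Z by rewrite e_t dvdz_mulr.
have [|a [b [t_ab /dvdzP[d a_d]]]] := IHn t e _ t_gt0 t_odd t_dvd; first by lia.
exists (e * d + s * b), d; split.
  have t_neq0 : t ^+ 2 != 0 by rewrite expf_neq0 //; lia.
  apply: (mulIf t_neq0).
  have -> : ((e * d + s * b) ^+ 2 + 3 * d ^+ 2) * t ^+ 2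
          = (e * (d * t) + (t * s) * b) ^+ 2 + 3 * (d * t) ^+ 2 by ring.
  rewrite -e_t -a_d.
  have -> : (e * (a - e * b) + (e ^+ 2 + 3) * b) ^+ 2 + 3 * (a - e * b) ^+ 2
          = (e ^+ 2 + 3) * (a ^+ 2 + 3 * b ^+ 2) by ring.
  by rewrite -t_ab e_t; ring.
have /dvdzP[k mk] := m_e.
apply/dvdzP; exists (b - k * d).
have -> : m = e + k * s by rewrite -mk; ring.
by ring.
Qed.

Lemma sqrD3_eq1 (c d : int) :
  c ^+ 2 + 3 * d ^+ 2 = 1 -> d = 0 /\ (c = 1 \/ c = -1).
Proof.
move=> cd1; have d0 : d = 0 by nia.
by split=> //; move: cd1; rewrite d0; nia.
Qed.

(** The conclusion is [p + q * r = (a + b * r) ^+ 3] in Z[r], with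
[r ^+ 2 = - 3], split into real and imaginary parts. *)
Lemma cube_root_sqrD3 (p q s : int) :
  coprimez p q -> ~~ (2 %| p + q)%Z -> p ^+ 2 + 3 * q ^+ 2 = s ^+ 3 ->
  exists a b : int,
    p = a * (a - 3 * b) * (a + 3 * b) /\ q = 3 * b * (a - b) * (a + b).
Proof.
move=> co_pq pq_odd N_s.
have N_gt0 : 0 < s ^+ 3.
  rewrite -N_s; have [q0 | q_neq0] := eqVneq q 0; last by nia.
  have : p != 0 by apply: contraNneq pq_odd => ->; rewrite q0.
  by nia.
have s_gt0 : 0 < s by nia.
have s_odd : ~~ (2 %| s)%Z.
  apply: contra pq_odd => s_even.
  have /dvdzP[k kE] : (2 %| s ^+ 3)%Z by rewrite dvdz_exp.
  have : (2 %| (p + q) * (p + q))%Z.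
    apply/dvdzP; exists (k + p * q - q ^+ 2).
    have -> : (p + q) * (p + q) = s ^+ 3 + 2 * (p * q - q ^+ 2).
      by rewrite -N_s; ring.
    by rewrite kE; ring.
  by rewrite even_mulz orbb.
(* Hence [q] has an inverse [v] modulo [D = s ^+ 3], and [m] is [p / q]. *)
have /coprimezP[[u v] /= bez] : coprimez (s ^+ 3) q.
  rewrite coprimez_sym -N_s /coprimez.
  have -> : p ^+ 2 + 3 * q ^+ 2 = (3 * q) * q + p ^+ 2 by ring.
  by rewrite gcdzMDl -/(coprimez _ _) coprimezXr // coprimez_sym.
move: bez N_s N_gt0; set D := s ^+ 3 => bez N_D D_gt0.
pose m := v * p.
have p_m : p = m * q + D * (u * p).
  have -> : m * q + D * (u * p) = (u * D + v * q) * p by rewrite /m; ring.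
  by rewrite bez mul1r.
have /dvdzP[h m_h] : (D %| m ^+ 2 + 3)%Z.
  have co_Dq : coprimez D (q ^+ 2).
    by apply/coprimezXr/coprimezP; exists (u, v).
  rewrite -(Gauss_dvdzl _ co_Dq); apply/dvdzP.
  exists (1 - (u * p) * (p + m * q)).
  have -> : (m ^+ 2 + 3) * q ^+ 2
          = p ^+ 2 + 3 * q ^+ 2 - (p - m * q) * (p + m * q) by ring.
  rewrite N_D (_ : p - m * q = D * (u * p)); last by rewrite {1}p_m; ring.
  by ring.
have [|a [b [s_ab /dvdzP[k a_k]]]] := @sqrD3_repr s m s_gt0 s_odd.
  by rewrite m_h /D; apply/dvdzP; exists (h * s ^+ 2); ring.
pose A := a * (a - 3 * b) * (a + 3 * b); pose B := 3 * b * (a - b) * (a + b).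
(* This is [(a - m * b) ^+ 3 = 0] modulo [D], expanded using [m ^+ 2 = - 3]. *)
have A_m : A = m * B + D * (k ^+ 3 - 3 * h * a * b ^+ 2 + h * m * b ^+ 3).
  have -> : A = m * B + (a - m * b) ^+ 3
                - (m ^+ 2 + 3) * (3 * a * b ^+ 2 - m * b ^+ 3).
    by rewrite /A /B; ring.
  by rewrite a_k m_h /D; ring.
have AB_D : A ^+ 2 + 3 * B ^+ 2 = D.
  by rewrite /D s_ab /A /B; ring.
move: A_m p_m; set k1 := (k ^+ 3 - _ + _); set k2 := u * p => A_m p_m.
(* [c + d * r] is the quotient [(p + q * r) * (A - B * r) / D]. *)
pose d := q * k1 - B * k2.
pose c := q * B * h + m * q * k1 + m * B * k2 + D * k1 * k2.
have c_E : p * A + 3 * q * B = D * c.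
  have -> : D * c = q * B * (h * D)
                    + D * (m * q * k1 + m * B * k2 + D * k1 * k2).
    by rewrite /c; ring.
  by rewrite -m_h p_m A_m; ring.
have d_E : q * A - p * B = D * d by rewrite p_m A_m /d; ring.
have D_neq0 : D != 0 by lia.
have cd1 : c ^+ 2 + 3 * d ^+ 2 = 1.
  apply: (mulfI (expf_neq0 2 D_neq0)).
  have -> : D ^+ 2 * (c ^+ 2 + 3 * d ^+ 2) = (D * c) ^+ 2 + 3 * (D * d) ^+ 2.
    by ring.
  rewrite -c_E -d_E mulr1 [RHS]expr2 -{1}N_D -AB_D; ring.
have [d0 c1] := sqrD3_eq1 _ _ cd1.
have p_c : p = c * A.
  apply: (mulIf D_neq0); rewrite -{1}AB_D.
  have -> : p * (A ^+ 2 + 3 * B ^+ 2)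
          = A * (p * A + 3 * q * B) - 3 * B * (q * A - p * B) by ring.
  by rewrite c_E d_E d0; ring.
have q_c : q = c * B.
  apply: (mulIf D_neq0); rewrite -{1}AB_D.
  have -> : q * (A ^+ 2 + 3 * B ^+ 2)
          = B * (p * A + 3 * q * B) + A * (q * A - p * B) by ring.
  by rewrite c_E d_E d0; ring.
have [{}c1 | {}c1] := c1.
  by exists a, b; rewrite p_c q_c c1 !mul1r.
by exists (- a), (- b); rewrite p_c q_c c1 /A /B; split; ring.
Qed.

(** * Infinite descent *)

Lemma sqrD3_cube_gt1 (p q s : int) :
  p != 0 -> q != 0 -> p ^+ 2 + 3 * q ^+ 2 = s ^+ 3 -> 1 < s.
Proof.
move=> p_neq0 q_neq0 s_N.
have : 1 < s ^+ 3 by rewrite -s_N; clear s_N; nia.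
have [s_ge0 | s_lt0] := leP 0 s; first by rewrite expr_gt1.
by rewrite exprS; have := sqr_ge0 s; clear -s_lt0; nia.
Qed.

(** With [x = p + q] and [y = p - q], the bound [`|c| < `|z|] holds because
[z] is, up to sign, [c] (or three times [c]) multiplied by the cube root of
[p ^+ 2 + 3 * q ^+ 2] (or of a third of it), which exceeds 1. *)
Lemma descent_step (x y z : int) :
  coprimez x y -> (2 %| z)%Z -> z != 0 -> x ^+ 3 + y ^+ 3 + z ^+ 3 = 0 ->
  exists u v w c : int,
    [/\ u + v + w = 0, coprimez u v, u * v * w = c ^+ 3, c != 0 & `|c| < `|z|].
Proof.
move=> co_xy z_even z_neq0 xyz0.
have even_cube t : (2 %| t ^+ 3)%Z = (2 %| t)%Z.
  by rewrite !exprS expr0 mulr1 !even_mulz !orbb.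
have [x_odd xy_even] : ~~ (2 %| x)%Z /\ (2 %| x - y)%Z.
  have z3_even : (2 %| z ^+ 3)%Z by rewrite even_cube.
  have co_even := coprimez_Nboth_even _ _ co_xy.
  have xy_even : (2 %| x)%Z = (2 %| y)%Z.
    by rewrite -[LHS]even_cube -[RHS]even_cube; move: z3_even xyz0; clear; lia.
  by move: co_even xy_even; clear; lia.
have [p [q [x_pq y_pq]]] : exists p q : int, x = p + q /\ y = p - q.
  by exists ((x + y) %/ 2)%Z, ((x - y) %/ 2)%Z; lia.
subst x y.
have co_pq : coprimez p q.
  have /coprimezP[[i j] /= bez] := co_xy; apply/coprimezP.
  by exists (i + j, i - j); rewrite /= -bez; ring.
have pq_z : 2 * p * (p ^+ 2 + 3 * q ^+ 2) = (- z) ^+ 3.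
  have -> : (- z) ^+ 3 = (p + q) ^+ 3 + (p - q) ^+ 3
                        - ((p + q) ^+ 3 + (p - q) ^+ 3 + z ^+ 3) by ring.
  by rewrite xyz0; ring.
have N_odd : ~~ (2 %| p ^+ 2 + 3 * q ^+ 2)%Z.
  have -> : p ^+ 2 + 3 * q ^+ 2 = (p + q) * (p + q) + 2 * (q ^+ 2 - p * q).
    by ring.
  have : ~~ (2 %| (p + q) * (p + q))%Z by rewrite even_mulz orbb.
  by lia.
(* The odd norm leaves to [2 * p] all factors 2 of the cube, at least three. *)
have p_even : (2 %| p)%Z.
  have /dvdzP[k kE] := z_even.
  have : (2 %| p * (p ^+ 2 + 3 * q ^+ 2))%Z.
    apply/dvdzP; exists (- 2 * k ^+ 3); apply: (@mulfI _ 2) => //.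
    by rewrite mulrA pq_z kE; ring.
  by rewrite even_mulz (negPf N_odd) orbF.
have q_odd : ~~ (2 %| q)%Z by apply: coprimez_Nboth_even p_even.
have p_neq0 : p != 0.
  by apply: contraNneq z_neq0 => p0; move: pq_z; rewrite p0 => /esym/eqP;
    rewrite mulr0 mul0r expf_eq0 oppr_eq0.
have co_pN k : (k %| p)%Z -> coprimez k 3 -> coprimez k (p ^+ 2 + 3 * q ^+ 2).
  move=> k_p co_k3; have /dvdzP[l pE] := k_p.
  have -> : p ^+ 2 + 3 * q ^+ 2 = (l * p) * k + 3 * q ^+ 2.
    by rewrite expr2 {2}pE; ring.
  rewrite /coprimez gcdzMDl -/(coprimez _ _) coprimezMr co_k3 /=.
  exact/coprimezXr/(coprimez_dvd _ _ _ _ k_p (dvdzz q)).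
have q_neq0 : q != 0 by apply: contraNneq q_odd => ->.
have [p3 | p3] := boolP (3 %| p)%Z; last first.
- have co_2pN : coprimez (2 * p) (p ^+ 2 + 3 * q ^+ 2).
    rewrite coprimezMl (coprimez_prime 2) // N_odd.
    by rewrite co_pN ?dvdzz // coprimez_sym (coprimez_prime 3).
  have [c c_p] := coprimez_mul_cube _ _ _ co_2pN pq_z.
  rewrite coprimez_sym in co_2pN; rewrite mulrC in pq_z.
  have [s s_N] := coprimez_mul_cube _ _ _ co_2pN pq_z.
  have [a [b [p_ab q_ab]]] := cube_root_sqrD3 _ _ _ co_pq x_odd s_N.
  exists (a - 3 * b), (- (2 * a)), (a + 3 * b), (- c); split.
  + by ring.
  + have p_dvd : (a - 3 * b %| p)%Z by rewrite p_ab dvdz_mulr ?dvdz_mull.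
    have q_dvd : (3 * b %| q)%Z by rewrite q_ab -!mulrA mulrA dvdz_mulr.
    rewrite coprimezN coprimezMr coprimez_sym (coprimez_prime 2) //.
    apply/andP; split.
      apply: contra q_odd => ab_even; rewrite q_ab !even_mulz.
      by apply/orP; left; apply/orP; right; clear -ab_even; lia.
    rewrite /coprimez -{2}[a](subrK (3 * b)) -{2}[a - _]mul1r gcdzMDl.
    exact: coprimez_dvd p_dvd q_dvd co_pq.
  + have -> : (- c) ^+ 3 = - (2 * p) by rewrite c_p; ring.
    by rewrite p_ab; ring.
  + apply: contraNneq p_neq0 => c0.
    by move: c_p; rewrite -[c]opprK c0; clear; lia.
  + have s_gt1 := sqrD3_cube_gt1 _ _ _ p_neq0 q_neq0 s_N.
    rewrite s_N c_p mulrC -exprMn in pq_z.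
    rewrite normrN -[`|z|]normrN.
    by apply: (cube_factor_lt _ _ _ pq_z) s_gt1 _; rewrite oppr_eq0.
(* Now [p = 3 * t]; moving the 3 out of the norm gives coprime factors
   [18 * t] and [q ^+ 2 + 3 * t ^+ 2], where [q] and [t] exchange roles. *)
have /dvdzP[t p_t] := p3.
have t_neq0 : t != 0 by apply: contraNneq p_neq0 => t0; rewrite p_t t0.
have t_even : (2 %| t)%Z by move: p_even; rewrite p_t; clear; lia.
have co_dvd_pq k l : (k %| p)%Z -> (l %| q)%Z -> coprimez k l.
  by move=> k_p l_q; apply: coprimez_dvd k_p l_q co_pq.
have co_qt : coprimez q t.
  by rewrite coprimez_sym co_dvd_pq ?dvdzz // p_t dvdz_mulr.
have tq_z : 18 * t * (q ^+ 2 + 3 * t ^+ 2) = (- z) ^+ 3.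
  by rewrite -pq_z p_t; ring.
have co_tM : coprimez (18 * t) (q ^+ 2 + 3 * t ^+ 2).
  have -> : 18 * t = 2 * (3 * (3 * t)) by ring.
  rewrite !coprimezMl (coprimez_prime 2) // (coprimez_prime 3) //.
  have -> : (2 %| q ^+ 2 + 3 * t ^+ 2)%Z = false.
    apply: contraNF N_odd; rewrite p_t => M_even.
    have -> : (t * 3) ^+ 2 + 3 * q ^+ 2 = 3 * (q ^+ 2 + 3 * t ^+ 2) by ring.
    by rewrite dvdz_mull.
  have -> : (3 %| q ^+ 2 + 3 * t ^+ 2)%Z = false.
    apply: negbTE; rewrite -(coprimez_prime 3) // addrC [3 * _]mulrC.
    rewrite /coprimez gcdzMDl -/(coprimez _ _).
    by rewrite coprimezXr // co_dvd_pq ?dvdzz.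
  rewrite addrC expr2 mulrA /coprimez gcdzMDl -/(coprimez _ _) coprimezXr //.
  by rewrite coprimez_sym.
have [c c_t] := coprimez_mul_cube _ _ _ co_tM tq_z.
rewrite coprimez_sym in co_tM; rewrite mulrC in tq_z.
have [s s_M] := coprimez_mul_cube _ _ _ co_tM tq_z.
have qt_odd : ~~ (2 %| q + t)%Z by move: q_odd t_even; clear; lia.
have [a [b [q_ab t_ab]]] := cube_root_sqrD3 _ _ _ co_qt qt_odd s_M.
have /dvdzP[d c_d] : (3 %| c)%Z.
  have : (3 %| c ^+ 3)%Z by rewrite -c_t; apply/dvdzP; exists (6 * t); ring.
  by rewrite dvdzE abszX Euclid_dvdX // andbT.
have d_ab : 2 * b * (a - b) * (a + b) = d ^+ 3.
  apply: (@mulfI _ 27) => //.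
  have -> : 27 * d ^+ 3 = c ^+ 3 by rewrite c_d; ring.
  by rewrite -c_t t_ab; ring.
exists (a - b), (2 * b), (- (a + b)), (- d); split.
- by ring.
- rewrite coprimezMr coprimez_sym (coprimez_prime 2) //; apply/andP; split.
    apply: contra q_odd => ab_even; rewrite q_ab !even_mulz.
    by apply/orP; left; apply/orP; right; clear -ab_even; lia.
  have : coprimez a (a - b).
    apply: coprimez_dvd co_qt; first by rewrite q_ab -mulrA dvdz_mulr.
    by rewrite t_ab dvdz_mulr ?dvdz_mull.
  move=> /coprimezP[[i j] /= bez]; apply/coprimezP.
  by exists (i + j, i); rewrite /= -bez; ring.
- have -> : (- d) ^+ 3 = - d ^+ 3 by ring.
  by rewrite -d_ab; ring.
- rewrite oppr_eq0; apply: contraNneq t_neq0 => d0.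
  by move: c_t; rewrite c_d d0; clear; lia.
- have s_gt1 := sqrD3_cube_gt1 _ _ _ q_neq0 t_neq0 s_M.
  rewrite s_M c_t mulrC -exprMn in tq_z.
  have : `|c| < `|- z|.
    by apply: (cube_factor_lt _ _ _ tq_z) s_gt1 _; rewrite oppr_eq0.
  by rewrite c_d; clear; lia.
Qed.

(** Equivalent to Fermat's last theorem for exponent 3, but this form
is symmetric in the three integers and is the one that the descent step
reproduces. *)
Lemma zero_sum_cube_product (u v w c : int) :
  u + v + w = 0 -> coprimez u v -> u * v * w = c ^+ 3 -> c = 0.
Proof.
have [n] : exists n : nat, `|c| < n%:Z by exists `|c|.+1; lia.
elim: n u v w c => [|n IHn] u v w c; first by lia.
(* The sum being even, so is one of the three terms. *)
wlog w_even : u v w / (2 %| w)%Z.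
  move=> wlog_even lt_cn uvw0 co_uv uvw_c.
  have [w_even | w_odd] := boolP (2 %| w)%Z; first exact: (wlog_even u v w).
  have [v_even | v_odd] := boolP (2 %| v)%Z.
    apply: (wlog_even u w v) => //; [by rewrite -uvw0; ring| |].
      have /coprimezP[[i j] /= bez] := co_uv; apply/coprimezP.
      by exists (i - j, - j); rewrite /= -bez (_ : w = - u - v); [ring | lia].
    by rewrite -uvw_c; ring.
  have u_even : (2 %| u)%Z by lia.
  apply: (wlog_even w v u) => //; [by rewrite -uvw0; ring| |].
    have /coprimezP[[i j] /= bez] := co_uv; apply/coprimezP.
    by exists (- i, j - i); rewrite /= -bez (_ : w = - u - v); [ring | lia].
  by rewrite -uvw_c; ring.
move=> lt_cn uvw0 co_uv uvw_c.
have [// | c_neq0] := eqVneq c 0; exfalso.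
have w_uv : w = - u - v by lia.
have [co_u_vw co_v_uw co_w_uv] :
  [/\ coprimez u (v * w), coprimez v (u * w) & coprimez w (u * v)].
  have /coprimezP[[i j] /= bez] := co_uv.
  have co_uw : coprimez u w.
    by apply/coprimezP; exists (i - j, - j); rewrite /= -bez w_uv; ring.
  have co_vw : coprimez v w.
    by apply/coprimezP; exists (j - i, - i); rewrite /= -bez w_uv; ring.
  rewrite !coprimezMr co_uv co_uw co_vw coprimez_sym co_uv.
  by rewrite [coprimez w u]coprimez_sym co_uw coprimez_sym co_vw.
have [x u_x] : exists x, u = x ^+ 3.
  by apply: (coprimez_mul_cube _ _ c co_u_vw); rewrite -uvw_c mulrA.
have [y v_y] : exists y, v = y ^+ 3.
  by apply: (coprimez_mul_cube _ _ c co_v_uw); rewrite -uvw_c; ring.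
have [z w_z] : exists z, w = z ^+ 3.
  by apply: (coprimez_mul_cube _ _ c co_w_uv); rewrite -uvw_c; ring.
have c_xyz : `|c| = `|x| * `|y| * `|z|.
  apply/eqP; rewrite -(@eqrXn2 _ 3) ?mulr_ge0 // -!normrM -!normrX.
  by rewrite -uvw_c u_x v_y w_z !exprMn.
have : 0 < `|c| by rewrite normr_gt0.
rewrite c_xyz => xyz_gt0.
have [x_gt0 y_gt0 z_neq0] : [/\ 0 < `|x|, 0 < `|y| & z != 0].
  by rewrite !normr_gt0; split; apply: contraTneq xyz_gt0 => ->;
     rewrite normr0 ?(mul0r, mulr0).
have co_xy : coprimez x y.
  apply: coprimez_dvd co_uv; [rewrite u_x | rewrite v_y]; exact: dvdz_exp.
have z_even : (2 %| z)%Z.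
  by move: w_even; rewrite w_z dvdzE abszX Euclid_dvdX // andbT.
rewrite u_x v_y w_z in uvw0.
have [u' [v' [w' [c' [uvw0' co_uv' uvw_c' c_neq0' lt_cz]]]]] :=
  descent_step _ _ _ co_xy z_even z_neq0 uvw0.
move/eqP: c_neq0'; apply; apply: (IHn u' v' w') => //.
rewrite c_xyz in lt_cn; clear -lt_cn lt_cz x_gt0 y_gt0.
have : `|z| <= `|x| * `|y| * `|z|.
  by rewrite ler_peMl // -gtz0_ge1 mulr_gt0.
by lia.
Qed.

Local Close Scope ring_scope.

Theorem theorem1p1 :
  ~ exists n b a1 a2 : nat,
      (0 < n /\ 0 < b /\ 0 < a1 /\ 0 < a2) /\
      (n = a1 + a2 /\ a1 * a2 * (a1 + a2) = b ^ 3).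
Proof.
case=> n [b [a1 [a2 [[_ [b_gt0 [a1_gt0 a2_gt0]]] [_ a_b]]]]].
set g := gcdn a1 a2; have g_gt0 : 0 < g by rewrite gcdn_gt0 a1_gt0.
have /dvdnP[u a1_u] : g %| a1 by apply: dvdn_gcdl.
have /dvdnP[v a2_v] : g %| a2 by apply: dvdn_gcdr.
have co_uv : coprime u v.
  have := erefl g; rewrite {1}/g a1_u a2_v -muln_gcdl => /eqP.
  by rewrite -{2}[g]mul1n eqn_pmul2r.
clearbody g; subst a1 a2.
have g3_b : g ^ 3 * (u * v * (u + v)) = b ^ 3 by rewrite -a_b; ring.
have /dvdnP[c b_c] : g %| b.
  by rewrite -(@dvdn_pexp2r _ _ 3) // -g3_b dvdn_mulr.
have uv_c : u * v * (u + v) = c ^ 3.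
  apply/eqP; rewrite -(@eqn_pmul2l (g ^ 3)) ?expn_gt0 ?g_gt0 //.
  by rewrite g3_b b_c expnMn mulnC.
have c0 : (- c%:Z)%R = 0%R.
  apply: (@zero_sum_cube_product u%:Z v%:Z (- (u + v)%:Z)%R) => //.
    by clear; lia.
  have -> : ((- c%:Z) ^+ 3)%R = (- (c ^ 3)%:Z)%R by lia.
  by rewrite -uv_c; clear; lia.
by move: b_gt0; rewrite b_c; clear -c0; lia.
Qed.
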